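(* For every integer $a\ge 2$, $$\beta_b(\overrightarrow{C}(2a;1,a)) = \beta_b(\overrightarrow{C}(2a;1,-a)) = \mathrm{diam}(\overrightarrow{C}(2a;1,a)) = a.$$
   Context: For integers $n\ge 3$ and $b_1,\dots,b_k$, the oriented circulant graph $\overrightarrow{C}(n;b_1,\dots,b_k)$ has vertex set $\{v_0,\dots,v_{n-1}\}$ and arc set $\{v_iv_{i+b_j} : 0\le i\le n-1,\ 1\le j\le k\}$, with subscripts taken modulo $n$ (negative $b_j$ allowed). For a vertex pair $u,v$, $d(u,v)$ is the length (number of arcs) of a shortest directed path from $u$ to $v$. The eccentricity of $v$ is $e(v)=\max_u d(v,u)$, and $\mathrm{diam}$ denotes the maximum eccentricity. An independent broadcast on an oriented graph $\overrightarrow{G}$ is a function $f:V(\overrightarrow{G})\to\{0,1,\dots,\mathrm{diam}(\overrightarrow{G})\}$ such that $f(v)\le e(v)$ for every vertex $v$, and $d(u,v)>f(u)$ for every two distinct vertices $u,v$ with $f(u)>0$ and $f(v)>0$. Its cost is $\sigma(f)=\sum_v f(v)$. The broadcast independence number $\beta_b(\overrightarrow{G})$ is the maximum cost of an independent broadcast on $\overrightarrow{G}$. *)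

(* Defs.v *)
From mathcomp Require Import all_boot all_order all_algebra.
Set Implicit Arguments.
Unset Strict Implicit.
Unset Printing Implicit Defensive.

Section Digraph.
Variables (T : finType) (e : rel T).

Definition has_dpath (u v : T) (k : nat) : bool :=
  [exists p : k.-tuple T, [&& path e u p, last u p == v & uniq (u :: p)]].

(* Directed paths have fewer than #|T| arcs, so [find] returns the least length
   of a path from u to v. If v is not reachable from u it returns #|T|, which
   stands for an infinite distance; this does not occur in a strongly connected
   digraph, hence not in a circulant having 1 among its connections. *)
Definition dist (u v : T) : nat := find (has_dpath u v) (iota 0 #|T|).

Definition ecc (v : T) : nat := \max_(u : T) dist v u.

Definition diam : nat := \max_(v : T) ecc v.

Definition indep_broadcast (f : {ffun T -> 'I_diam.+1}) : bool :=
  [forall v, f v <= ecc v] &&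
  [forall u, forall v, [&& u != v, 0 < f u & 0 < f v] ==> (f u < dist u v)].

Definition cost (f : {ffun T -> 'I_diam.+1}) : nat := \sum_(v : T) f v.

Definition broadcast_indep_number : nat :=
  \max_(f : {ffun T -> 'I_diam.+1} | indep_broadcast f) cost f.

End Digraph.

Definition circulant (n : nat) (bs : seq int) : rel 'I_n :=
  fun i j => has (fun b : int => (j%:Z == i%:Z + b %[mod n%:Z])%Z) bs.

(* Main.v *)
Require Import Defs.
From mathcomp Require Import all_boot all_order all_algebra.
From mathcomp Require Import zify.

Set Implicit Arguments.
Unset Strict Implicit.
Unset Printing Implicit Defensive.

(** Modulo [a] the vertex [u + s] or its antipode [u + s + a] is within
    [s + 1] arcs of [u]. Hence in an independent broadcast [f] the cyclic
    intervals [{u, ..., u + f u - 1}] of Z/a, for [f u > 0], are pairwise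
    disjoint, so the cost is at most [a]; giving the value [a] to a single
    vertex attains this. *)

Section Distance.
Variables (T : finType) (e : rel T).

(** Cutting the loops out of a walk gives a simple path, hence one with fewer than [#|T|] arcs, and
    [find] meets its length. *)
Lemma dist_last_le (u : T) (p : seq T) :
  path e u p -> dist e u (last u p) <= size p.
Proof.
case/shortenP=> q eq uq sub_qp.
have leq_qp : size q <= size p.
  by apply: uniq_leq_size => //; case/andP: uq.
apply: leq_trans leq_qp.
have ltqT : size q < #|T|.
  by rewrite -[(size q).+1]/(size (u :: q)) -(card_uniqP uq) max_card.
rewrite /dist leqNgt; apply/negP => /(before_find 0).
rewrite nth_iota // add0n // => /negbT/existsPn/(_ (in_tuple q)).
by rewrite eq uq eqxx.
Qed.

(** A path gains at most one unit of [phi] per arc. The bound [m <= #|T|] covers an unreachable [v],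
    where [dist] takes its default value [#|T|]. *)
Lemma dist_ge_potential (phi : T -> nat) (u v : T) (m : nat) :
  (forall x y, e x y -> phi y <= (phi x).+1) ->
  phi u + m <= phi v -> m <= #|T| -> m <= dist e u v.
Proof.
move=> phi_step phi_uv le_mT.
have phi_path p : forall x, path e x p -> phi (last x p) <= phi x + size p.
  elim: p => [|y p IHp] x /=; first by rewrite addn0.
  by case/andP=> /phi_step exy /IHp; lia.
have [hasP|] := boolP (has (has_dpath e u v) (iota 0 #|T|)); last first.
  by move/hasNfind; rewrite /dist => ->; rewrite size_iota.
have := nth_find 0 hasP; move: (hasP); rewrite has_find size_iota => ltT.
rewrite nth_iota // add0n -/(dist e u v).
case/existsP=> p /and3P[/phi_path + /eqP last_p _].
by rewrite last_p size_tuple; lia.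
Qed.

Lemma dist_le_ecc (u v : T) : dist e u v <= ecc e u.
Proof. exact: (leq_bigmax (F := dist e u)). Qed.

Lemma ecc_le_diam (u : T) : ecc e u <= diam e.
Proof. exact: (leq_bigmax (F := ecc e)). Qed.

(** A broadcast supported on [u] alone satisfies the distance condition vacuously, so it may take
    the value [dist e u v]. *)
Lemma dist_le_broadcast_indep_number (u v : T) :
  dist e u v <= broadcast_indep_number e.
Proof.
have lt_d : dist e u v < (diam e).+1.
  by rewrite ltnS (leq_trans (dist_le_ecc u v)) ?ecc_le_diam.
pose f := [ffun x => if x == u then Ordinal lt_d else ord0].
have f_ind : indep_broadcast f.
  apply/andP; split.
    apply/forallP=> x; rewrite ffunE; case: eqP => [->|_] //.
    exact: dist_le_ecc.
  apply/forallP=> x; apply/forallP=> y; rewrite !ffunE.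
  by have [->|_] := eqVneq x u; have [->|_] := eqVneq y u; rewrite ?eqxx ?andbF.
apply: leq_trans (leq_bigmax_cond (F := @cost _ _) f f_ind).
by rewrite /cost (bigD1 u) //= ffunE eqxx leq_addr.
Qed.

End Distance.

Section Antipodal.
Variables (a : nat) (e : rel 'I_(2 * a)).
Hypothesis a_ge2 : 2 <= a.
(** Only this adjacency is used below, so the results apply to both circulants at once. *)
Hypothesis eE : forall x y : 'I_(2 * a),
  e x y = (y == x.+1 %% (2 * a) :> nat) || (y == (x + a) %% (2 * a) :> nat).

Let a_gt0 : 0 < a. Proof. exact: ltnW. Qed.

Lemma circ_path (s : nat) (u v : 'I_(2 * a)) :
  v = (u + s) %% (2 * a) :> nat ->
  exists p, [/\ path e u p, last u p = v & size p = s].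
Proof.
elim: s u => [|s IHs] u def_v.
  exists [::]; split=> //=; apply: val_inj; rewrite /= def_v addn0.
  by rewrite modn_small.
have lt_u' : u.+1 %% (2 * a) < 2 * a by rewrite ltn_mod; lia.
have [|p [ep lp sp]] := IHs (Ordinal lt_u').
  by rewrite def_v /= modnDml addSnnS.
by exists (Ordinal lt_u' :: p); split; rewrite /= ?ep ?sp // eE /= eqxx.
Qed.

(** Either [s] unit arcs lead from [u] to [v], or one arc to the antipode of [u] followed by [s]
    unit arcs does. *)
Lemma circ_dist_le (s : nat) (u v : 'I_(2 * a)) :
  v = u + s %[mod a] -> dist e u v <= s.+1.
Proof.
move=> def_v.
have [] : v = (u + s) %% (2 * a) :> nat \/ v = (u + a + s) %% (2 * a) :> nat.
(* Two numbers below [2 * a] that agree modulo [a] are equal or differ by exactly [a]. *)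
- have lt_v := ltn_ord v.
  have lt_w : (u + s) %% (2 * a) < 2 * a by rewrite ltn_mod; lia.
  have def_w : (u + s) %% (2 * a) = v %[mod a].
    by rewrite modn_dvdm ?dvdn_mull // def_v.
  rewrite addnAC -(modnDml (u + s)).
  move: lt_w def_w; move: (_ %% (2 * a)) => w lt_w def_w.
  have [lt_wa|le_aw] := ltnP w a; have [lt_va|le_av] := ltnP v a.
  + by left; rewrite !modn_small in def_w.
  + right; rewrite -(subnK le_av) modnDr !modn_small in def_w; try lia.
    by rewrite modn_small; lia.
  + right; rewrite -(subnK le_aw) modnDr !modn_small in def_w; try lia.
    have -> : w + a = w - a + 2 * a by lia.
    by rewrite modnDr modn_small; lia.
  + left; rewrite -(subnK le_aw) -(subnK le_av) !modnDr !modn_small in def_w;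
      lia.
- by case/circ_path=> p [ep <- <-]; apply: leqW; apply: dist_last_le.
have lt_u' : (u + a) %% (2 * a) < 2 * a by rewrite ltn_mod; lia.
move=> def_v'; have [|p [ep <- <-]] := @circ_path s (Ordinal lt_u') v.
  by rewrite def_v' /= modnDml.
by apply: (@dist_last_le _ e u (_ :: p)); rewrite /= ep eE /= eqxx orbT.
Qed.

Lemma circ_dist_le_half (u v : 'I_(2 * a)) : dist e u v <= a.
Proof.
(* This is [v - u] modulo [a], written so that the subtraction does not truncate. *)
pose s := (v + (a - u %% a)) %% a.
have lt_sa : s < a by rewrite ltn_mod.
apply: leq_trans lt_sa; apply: circ_dist_le.
rewrite /s modnDmr -modnDml addnCA subnKC; last by rewrite ltnW ?ltn_mod.
by rewrite modnDr.
Qed.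

Lemma circ_dist_ge_half (u v : 'I_(2 * a)) :
  u = 0 :> nat -> v = (2 * a).-1 :> nat -> a <= dist e u v.
Proof.
move=> u0 v_max.
(* [phi x] is the actual distance from 0 to [x]. *)
pose phi (x : 'I_(2 * a)) : nat := if x < a then x : nat else x - a + 1.
apply: (@dist_ge_potential _ e phi); last by rewrite card_ord; lia.
- move=> x y; rewrite eE /phi; have lt_x := ltn_ord x.
  case/orP=> /eqP ->.
    have [lt_x1|] := ltnP x.+1 (2 * a).
      by rewrite modn_small //; do 2!case: ifP; lia.
    move=> le_x1; have ->: x.+1 = 2 * a by lia.
    by rewrite modnn a_gt0.
  have [lt_xa|le_ax] := ltnP x a.
    by rewrite modn_small; [case: ifP; lia | lia].
  (* From the upper half the antipodal arc wraps around to [x - a], and the potential drops by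
     one. *)
  have ->: x + a = x - a + 2 * a by lia.
  by rewrite modnDr modn_small; [case: ifP; lia | lia].
- by rewrite /phi u0 v_max a_gt0; case: ifP; lia.
Qed.

(** Such a pair gives the lower bound for both the diameter and the broadcast number. *)
Lemma circ_far_pair : exists u v : 'I_(2 * a), a <= dist e u v.
Proof.
have lt0 : 0 < 2 * a by lia.
have ltM : (2 * a).-1 < 2 * a by lia.
by exists (Ordinal lt0), (Ordinal ltM); apply: circ_dist_ge_half.
Qed.

Lemma circ_diam : diam e = a.
Proof.
apply/eqP; rewrite eqn_leq; apply/andP; split.
  by apply/bigmax_leqP=> u _; apply/bigmax_leqP=> v _; apply: circ_dist_le_half.
have [u [v le_a]] := circ_far_pair.
exact: leq_trans le_a (leq_trans (dist_le_ecc e u v) (ecc_le_diam e u)).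
Qed.

Lemma circ_cost_le (f : {ffun 'I_(2 * a) -> 'I_(diam e).+1}) :
  indep_broadcast f -> cost f <= a.
Proof.
case/andP=> _ /forallP f_ind.
have f_le u : f u <= a by rewrite -[leqRHS]circ_diam -ltnS.
(* If two intervals meet, then [v] is [u + (j - k)] modulo [a], so [dist e u v <= j - k + 1 <= f u],
   against independence. *)
have far (u v : 'I_(2 * a)) (j k : 'I_a) : j < f u -> k < f v -> k <= j ->
    u + j = v + k %[mod a] -> u = v.
  move=> lt_j lt_k le_kj E; apply/eqP; apply/negPn/negP => neq_uv.
  have /forallP/(_ v)/implyP := f_ind u; rewrite neq_uv /=.
  rewrite (leq_ltn_trans _ lt_j) // (leq_ltn_trans _ lt_k) // => /(_ isT).
  rewrite ltnNge => /negP; apply.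
  apply: leq_trans (_ : (j - k).+1 <= _); last by lia.
  apply: circ_dist_le; apply/eqP; rewrite -(eqn_modDr k) -addnA subnK //.
  exact/eqP.
(* The cost is the number of pairs [(u, j)] with [j < f u]; since [f u <= a], letting [j] range over
   ['I_a] loses none. *)
pose A := [set x : 'I_(2 * a) * 'I_a | x.2 < f x.1].
pose h (x : 'I_(2 * a) * 'I_a) := Ordinal (ltn_pmod (x.1 + x.2) a_gt0).
have h_inj : {in A &, injective h}.
  move=> [u j] [v k]; rewrite !inE /= => lt_j lt_k [E].
  have uv : u = v.
    by case/orP: (leq_total k j) => le; [|symmetry];
       [apply: far le E | apply: far le (esym E)].
  rewrite {}uv in E *; congr pair; apply: val_inj.
  by move/eqP: E; rewrite eqn_modDl !modn_small // => /eqP.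
have -> : cost f = #|A|.
  rewrite /cost -sum1_card.
  have A_E (x : 'I_(2 * a) * 'I_a) : (x \in A) = predT x.1 && (x.2 < f x.1).
    by rewrite inE.
  rewrite (eq_bigl _ _ A_E).
  rewrite -(pair_big_dep predT (fun u (j : 'I_a) => j < f u) (fun _ _ => 1)).
  apply: eq_bigr => u _.
  by rewrite -(big_ord_widen a (fun=> 1)) // sum1_card card_ord.
by rewrite -(card_in_imset h_inj) (leq_trans (max_card _)) ?card_ord.
Qed.

Lemma circ_broadcast_indep_number : broadcast_indep_number e = a.
Proof.
apply/eqP; rewrite eqn_leq; apply/andP; split.
  by apply/bigmax_leqP=> f; apply: circ_cost_le.
have [u [v le_a]] := circ_far_pair.
exact: leq_trans le_a (dist_le_broadcast_indep_number e u v).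
Qed.

End Antipodal.

(** A connection matters only modulo [2 * a], where [a] and [-a] coincide. *)
Lemma circulantE (a : nat) (b : int) : 2 <= a ->
  (b = a%:Z %[mod (2 * a)%N%:Z])%Z ->
  forall x y : 'I_(2 * a), circulant [:: 1%Z; b] x y =
    (y == x.+1 %% (2 * a) :> nat) || (y == (x + a) %% (2 * a) :> nat).
Proof.
move=> a_ge2 Eb x y; rewrite /circulant /= orbF.
have E (m : nat) : (y%:Z == m%:Z %[mod (2 * a)%N%:Z])%Z
    = (y == m %% (2 * a) :> nat).
  by rewrite !modz_nat eqz_nat modn_small.
rewrite -(modzDmr _ b) Eb modzDmr -!E.
by rewrite -[x.+1]addn1 !PoszD.
Qed.

Theorem theorem3 (a : nat) (ha : 2 <= a) :
  [/\ broadcast_indep_number (circulant (n := 2 * a) [:: 1%Z; a%:Z]%R)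
      = broadcast_indep_number (circulant (n := 2 * a) [:: 1%Z; (- a%:Z)%R]),
      broadcast_indep_number (circulant (n := 2 * a) [:: 1%Z; (- a%:Z)%R])
      = diam (circulant (n := 2 * a) [:: 1%Z; a%:Z]%R)
    & diam (circulant (n := 2 * a) [:: 1%Z; a%:Z]%R) = a].
Proof.
have E1 := @circulantE a a%:Z%R ha erefl.
have /(@circulantE a _ ha) E2 : (- a%:Z = a%:Z %[mod (2 * a)%N%:Z])%Z.
  have -> : (a%:Z = - a%:Z + (2 * a)%N%:Z)%R by lia.
  by rewrite modzDr; congr (_ %% _)%Z; lia.
by rewrite !circ_broadcast_indep_number // circ_diam.
Qed.
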